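(* Let $c\geq 0$ and $n$ be integers with $n\geq (2c+3)^2$. Then $$\left((-1)^c+\sum_{M\in \mathcal{N}[n-1-c]}M\right)\cdot(c+1)\equiv 0\pmod{n}$$ if and only if $n=(c+1)p$ for some prime number $p$.
   Context: For a positive integer $n$ and an integer $0\le k\le n-1$, $\mathcal{N}[k]$ denotes the multiset consisting of the $\binom{n-1}{k}$ products of the elements of the $k$-element subsets of $\mathcal{N}=\{1,\ldots,n-1\}$ (one product for each subset, so repeated values are counted with multiplicity; the empty product is $1$). Thus $\sum_{M\in\mathcal{N}[k]}M=\sum_{S\subseteq\{1,\ldots,n-1\},\,|S|=k}\ \prod_{m\in S}m$. *)

(* Defs.v *)
From mathcomp Require Import all_boot all_order all_algebra.

Set Implicit Arguments.
Unset Strict Implicit.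
Unset Printing Implicit Defensive.

Definition calN (n : nat) : {set 'I_n} := [set m : 'I_n | 0 < m].

(* A multiset is encoded as a sequence whose order is irrelevant:
   one entry for each k-element subset, equal values not being merged. *)
Definition subset_products (n k : nat) : seq nat :=
  [seq \prod_(m in A) (m : nat)
     | A : {set 'I_n} in [set A in powerset (calN n) | #|A| == k]].

(* Main.v *)
Require Import Defs.
From mathcomp Require Import all_boot all_order all_algebra all_field.
From mathcomp Require Import zify.

(** The sum is the coefficient of [X^(c+1)] in [X (X+1) ... (X+n-1)].  If a
    prime [q] divides [n = q m], that polynomial is [(X^q - X)^m] over [F_q], so
    for [c + 1 < max(m, q - 1)] the coefficient is [(-1)^m] if [m = c + 1] and [0]
    otherwise; as [n] is large, this covers every such [q].  The congruence
    makes [n / gcd(n, c+1) > 1] divide [(-1)^c + coefficient], so any prime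
    factor [q] of this quotient must satisfy [n = (c+1) q].  Conversely, for
    [n = (c+1) p] the same computation gives [p | (-1)^c + coefficient]. *)

Set Implicit Arguments.
Unset Strict Implicit.
Unset Printing Implicit Defensive.

Import Order.TTheory GRing.Theory Num.Theory.
Local Open Scope ring_scope.

(** Expand the product: taking constants on [J] and ['X] elsewhere gives degree [#|I| - #|J|]. *)
Lemma coef_prod_XaddC (R : comNzRingType) (I : finType) (a : I -> R) k :
  (k <= #|I|)%N ->
  (\prod_i ('X + (a i)%:P))`_k
  = \sum_(J : {set I} | #|J| == (#|I| - k)%N) \prod_(i in J) a i.
Proof.
move=> lekI; under eq_bigr do rewrite addrC.
rewrite bigA_distr coef_sum [RHS]big_mkcond /=; apply: eq_bigr => J _.
rewrite big_if /= -rmorph_prod /=.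
under [X in _ * X]eq_bigl do rewrite -in_setC.
rewrite prodr_const coefCM coefXn cardsCs setCK.
have leJI : (#|J| <= #|I|)%N by apply: max_card.
have -> : (k == #|I| - #|J|)%N = (#|J| == #|I| - k)%N by apply/eqP/eqP; lia.
by case: ifP; rewrite ?mulr1 ?mulr0.
Qed.

Lemma sum_subset_products (R : comNzRingType) n k : (k <= n)%N ->
  (\sum_(M <- subset_products n (n - k)) M)%N%:R
  = (\prod_(i < n) ('X + (i%:R)%:P))`_k :> R.
Proof.
move=> lekn; rewrite coef_prod_XaddC ?card_ord // /subset_products.
rewrite big_map big_enum /= natr_sum big_mkcond [RHS]big_mkcond /=.
apply: eq_bigr => J _; rewrite !inE; case: (#|J| == _); rewrite ?andbF //.
(* A subset outside [calN n] contains [0], so its product vanishes. *)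
rewrite andbT natr_prod; case: ifP => // /negbT /subsetPn[i iJ].
by rewrite inE -eqn0Ngt => /eqP i0; rewrite (bigD1 i) //= i0 mul0r.
Qed.

(** Each block of [q] consecutive constants runs once through ['F_q]. *)
Lemma prod_XaddC_Fp q m : prime q ->
  \prod_(i < q * m) ('X + (i%:R)%:P) = ('X^q - 'X) ^+ m :> {poly 'F_q}.
Proof.
move=> q_pr; have q0 : q%:R = 0 :> 'F_q by apply: pcharf0 (pchar_Fp q_pr).
elim: m => [|m IHm]; first by rewrite muln0 big_ord0.
rewrite mulnS addnC big_split_ord /= IHm exprSr; congr (_ * _).
under eq_bigr do rewrite natrD natrM q0 mul0r add0r.
have := finField_genPoly ('F_q); rewrite card_Fp // => ->.
rewrite [RHS](reindex_inj oppr_inj) /=.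
under [RHS]eq_bigr do rewrite polyCN opprK.
rewrite (reindex (cast_ord (Fp_cast q_pr))) /=; last first.
  by apply: onW_bij; exists (cast_ord (esym (Fp_cast q_pr))) => i; apply: val_inj.
by apply: eq_bigr => i _; rewrite natr_Zp.
Qed.

Lemma coef_XnsubX_exp (R : comNzRingType) q m k :
  (0 < q)%N -> (k < maxn m q.-1)%N ->
  (('X^q - 'X) ^+ m)`_k = (if k == m then (-1) ^+ m else 0) :> R.
Proof.
case: q => // q _ /= ltk.
have -> : 'X^(q.+1) - 'X = 'X * ('X^q - 1) :> {poly R}.
  by rewrite mulrBr mulr1 exprS.
rewrite exprMn coefXnM; case: (ltngtP k m) ltk => // [ltmk|->] ltk.
(* Since [('X^q - 1) - (-1) = 'X^q], the power [('X^q - 1) ^+ m] is [(-1) ^+ m] modulo ['X^q], and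
   [k - m < q]. *)
all: have := subrXX ('X^q - 1 : {poly R}) (-1) m; rewrite opprK subrK.
all: move/(canRL (subrK _)) => ->; rewrite coefD coefXnM -polyC1 -polyCN.
all: rewrite -polyC_exp coefC.
  by rewrite ifT ?add0r; [case: eqP => //; lia | lia].
by rewrite subnn ifT ?add0r //; lia.
Qed.

Theorem corollary4p3 (c n : nat) (hn : ((2 * c + 3) ^ 2 <= n)%N) :
  ((((-1) ^+ c + (\sum_(M <- subset_products n (n - 1 - c)) M)%N%:Z) * (c + 1)%N%:Z
     = 0 %[mod n%:Z])%Z)
  <-> (exists p : nat, prime p /\ n = ((c + 1) * p)%N).
Proof.
set X := (_ + _)%R.
(* If [n = q * m], then [m <= c + 1] and [q <= c + 2] cannot both hold, as [n] exceeds
   [4 * (c + 1) * (c + 2)]. *)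
have n_big : (4 * (c + 1) * (c + 1) + 4 * (c + 1) < n)%N.
  by apply: leq_trans hn; rewrite expnS expn1; lia.
have dvdX q m : prime q -> n = (q * m)%N ->
    (q%:Z %| X)%Z = ((-1) ^+ c + (('X^q - 'X) ^+ m)`_(c + 1) == 0 :> 'F_q).
  move=> q_pr def_n; rewrite (dvdz_pcharf (pchar_Fp q_pr)).
  rewrite rmorphD /= rmorphXn /= rmorphN1.
  rewrite -subnDA (addnC 1%N) -pmulrn sum_subset_products; last by lia.
  by rewrite def_n prod_XaddC_Fp.
have -> : ((X * (c + 1)%N%:Z = 0 %[mod n%:Z])%Z)
    <-> (n%:Z %| X * (c + 1)%N%:Z)%Z.
  by rewrite mod0z; split=> [/dvdz_mod0P|/dvdz_mod0P].
split=> [n_dvd | [p [p_pr def_n]]]; last first.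
  rewrite def_n mulnC PoszM dvdz_mul2r //; last by lia.
  rewrite (dvdX p (c + 1)%N) // 1?mulnC // coef_XnsubX_exp ?prime_gt0 //;
    last by nia.
  by rewrite eqxx addn1 exprS mulN1r subrr.
set g := gcdn n (c + 1).
have g_gt0 : (0 < g)%N by rewrite gcdn_gt0; lia.
have [u def_n] : exists u, n = (u * g)%N by apply/dvdnP/dvdn_gcdl.
have [v def_c] : exists v, (c + 1 = v * g)%N by apply/dvdnP/dvdn_gcdr.
have co_uv : coprime u v.
  by rewrite /coprime -(eqn_pmul2r g_gt0) muln_gcdl -def_n -def_c mul1n.
have u_gt1 : (1 < u)%N.
  have lt_gn : (g < n)%N.
    by apply: leq_ltn_trans (dvdn_leq _ (dvdn_gcdr n _)) _; lia.
  by rewrite -(ltn_pmul2r g_gt0) -def_n mul1n.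
(* Cancel [g] from [u * g] dividing [X * v * g], then drop [v], which is coprime to [u]. *)
have u_dvd : (u%:Z %| X)%Z.
  move: n_dvd; rewrite def_c def_n !PoszM mulrA dvdz_mul2r; last by lia.
  by rewrite Gauss_dvdzl.
have q_pr := pdiv_prime u_gt1; set q := pdiv u in q_pr.
have q_dvd : (q%:Z %| X)%Z by apply: dvdz_trans u_dvd; apply: pdiv_dvd.
have [m def_n'] : exists m, n = (m * q)%N.
  by apply/dvdnP; rewrite def_n dvdn_mulr ?pdiv_dvd.
exists q; split=> //; rewrite def_n'; congr (_ * _)%N.
move: q_dvd; rewrite (dvdX q m) //; last by rewrite mulnC.
rewrite coef_XnsubX_exp ?prime_gt0 //; last by nia.
(* For [m] other than [c + 1] the coefficient is 0, leaving [(-1) ^+ c = 0] in ['F_q], which is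
   absurd. *)
by case: ((c + 1)%N =P m) => // _; rewrite addr0 signr_eq0.
Qed.
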